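(* Let $l$ be an odd prime and $K$ a field with $\operatorname{char}K\ne2,l$ and $\operatorname{Gal}(K(\zeta_l)/K)\simeq(\mathbb{Z}/l\mathbb{Z})^\times$. Let $V\subset K^{l-1}$ be the algebraic $K$-variety defined by $f_m({\bf x})=0$ for $m=1,\dots,\frac{l-1}{2}-1$, where $$f_m(x_1,\dots,x_{l-1})=\sum_{i=1}^{l-1}x_ix_{i+m}-\sum_{i=1}^{l-1}x_ix_{i+(m+1)}$$ (subscripts modulo $l$, with $x_0=0$). Let $q({\bf x})=f_0({\bf x})=\sum_{i=1}^{l-1}x_i^2-\sum_{i=1}^{l-1}x_ix_{i+1}$. Then $q$ is a regular quadratic form which is multiplicative on $V$, i.e. there exists a bilinear map $\varphi:K^{l-1}\times K^{l-1}\to K^{l-1}$ with $\varphi(V\times V)\subset V$ and $q({\bf x})q({\bf y})=q(\varphi({\bf x},{\bf y}))$ for all ${\bf x},{\bf y}\in V$. Moreover, for each $d\in(\mathbb{Z}/l\mathbb{Z})^\times$ such a map is given by $\varphi_d({\bf x},{\bf y})=(z_{1,d},\dots,z_{l-1,d})$ with $$z_{k,d}=-\Big(\sum_{i=1}^{l-1}x_{-d^{-1}i}y_{k-i}-\sum_{i=1}^{l-1}x_{-d^{-1}i}y_{-i}\Big)\quad(k=1,\dots,l-1),$$ subscripts modulo $l$ with $x_0=y_0=0$.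
   Context: $\zeta_l$ is a primitive $l$-th root of unity. A quadratic form $q({\bf x})=\sum a_{ij}x_ix_j$ is regular if its symmetric coefficient matrix is invertible. Points of $V$ are its $K$-rational points. When $l=3$ there are no defining equations and $V=K^2$. *)

(* Defs.v *)
From mathcomp Require Import all_boot all_fingroup all_algebra all_solvable.
From mathcomp Require Import all_field sesquilinear.

Set Implicit Arguments.
Unset Strict Implicit.
Unset Printing Implicit Defensive.

Import GRing.Theory.
Local Open Scope ring_scope.

(* A vector of K^(l-1) is (x_1, ..., x_(l-1)), with x_i stored in column i - 1.
   [coord_mod x a] is x_a for a in Z/l: the sum has one term if a != 0 and none
   if a = 0, which gives the convention x_0 = 0. *)
Definition coord_mod (K : fieldType) (l : nat) (x : 'rV[K]_(l.-1)) (a : 'Z_l) :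
    K :=
  \sum_(j < l.-1 | (j.+1)%:R == a) x 0 j.

Definition f_form (K : fieldType) (l m : nat) (x : 'rV[K]_(l.-1)) : K :=
  \sum_(1 <= i < l) coord_mod x i%:R * coord_mod x (i + m)%N%:R
  - \sum_(1 <= i < l) coord_mod x i%:R * coord_mod x (i + (m + 1))%N%:R.

Definition q_form (K : fieldType) (l : nat) (x : 'rV[K]_(l.-1)) : K := f_form 0 x.

Definition in_V (K : fieldType) (l : nat) (x : 'rV[K]_(l.-1)) : Prop :=
  forall m : nat, (1 <= m <= (l.-1)./2 - 1)%N -> f_form m x = 0.

(* In characteristic different from 2 the symmetric matrix A is determined by
   the function Q. *)
Definition regular_quadratic_form (K : fieldType) (n : nat)
    (Q : 'rV[K]_n -> K) : Prop :=
  exists A : 'M[K]_n,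
    [/\ A^T = A,
        forall x : 'rV[K]_n, Q x = \sum_i \sum_j A i j * x 0 i * x 0 j
      & A \in unitmx].

Definition multiplication_map (K : fieldType) (n : nat) (W : 'rV[K]_n -> Prop)
    (Q : 'rV[K]_n -> K) (phi : 'rV[K]_n -> 'rV[K]_n -> 'rV[K]_n) : Prop :=
  [/\ bilinear_for *:%R *:%R phi,
      forall x y, W x -> W y -> W (phi x y)
    & forall x y, W x -> W y -> Q x * Q y = Q (phi x y)].

Definition multiplicative_on (K : fieldType) (n : nat) (W : 'rV[K]_n -> Prop)
    (Q : 'rV[K]_n -> K) : Prop :=
  exists phi : 'rV[K]_n -> 'rV[K]_n -> 'rV[K]_n, multiplication_map W Q phi.

(* Column k of the result is z_(k+1). *)
Definition phi_d (K : fieldType) (l : nat) (d : {unit 'Z_l})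
    (x y : 'rV[K]_(l.-1)) : 'rV[K]_(l.-1) :=
  \row_(k < l.-1)
    - (\sum_(1 <= i < l)
          coord_mod x (- (val d)^-1 * i%:R) * coord_mod y ((k.+1)%:R - i%:R)
       - \sum_(1 <= i < l)
          coord_mod x (- (val d)^-1 * i%:R) * coord_mod y (- i%:R)).

(* Main.v *)
(** Extend [x] to a function [X] on Z/l with [X 0 = 0] and view it in the group
    algebra K[Z/l], where [N] denotes the sum of all group elements.  The
    coefficient at [m] of [X * X^-], [X^-] being [X] precomposed with negation,
    is the autocorrelation of [X] at [m], and [x] lies in [V] exactly when
    [X * X^- = q(x) 1 + c N] for some [c].  Modulo the ideal [K N] this reads
    [X * X^- = q(x)], a condition which is multiplicative in [X] and invariant
    under automorphisms of Z/l; and every class modulo [K N] has exactly one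
    representative vanishing at 0.  For regularity, a vector in the kernel of
    the matrix of [q], extended by 0 at indices 0 and [l], is an arithmetic
    progression, so [l u_1 = u_l = 0]. *)

Require Import Defs.
From mathcomp Require Import all_boot all_fingroup all_algebra all_solvable.
From mathcomp Require Import all_field sesquilinear.
From mathcomp Require Import ring zify.

Set Implicit Arguments.
Unset Strict Implicit.
Unset Printing Implicit Defensive.

Import GRing.Theory.
Local Open Scope ring_scope.

(** * Convolution and autocorrelation on a finite abelian group *)

Section Convolution.

Variables (G : finZmodType) (K : fieldType).
Implicit Types (X Y : G -> K) (m : G).

Definition conv X Y m : K := \sum_i X i * Y (m - i).

Definition corr X m : K := \sum_i X i * X (i + m).

Lemma eq_conv X X' Y Y' : X =1 X' -> Y =1 Y' -> conv X Y =1 conv X' Y'.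
Proof. by move=> eX eY m; apply: eq_bigr => i _; rewrite eX eY. Qed.

Lemma convC X Y : conv X Y =1 conv Y X.
Proof.
move=> m; rewrite /conv (reindex_inj (inv_inj (subKr m))).
by apply: eq_bigr => i _; rewrite subKr mulrC.
Qed.

Lemma conv_linearl c X X' Y Z m :
  (forall i, Z i = c * X i + X' i) -> conv Z Y m = c * conv X Y m + conv X' Y m.
Proof.
move=> eZ; rewrite /conv mulr_sumr -big_split; apply: eq_bigr => i _.
by rewrite eZ mulrDl mulrA.
Qed.

Lemma conv_linearr c X Y Y' Z m :
  (forall i, Z i = c * Y i + Y' i) -> conv X Z m = c * conv X Y m + conv X Y' m.
Proof. by move=> eZ; rewrite ![conv X _ _]convC (conv_linearl _ _ eZ). Qed.

Lemma convA X Y (Z : G -> K) : conv X (conv Y Z) =1 conv (conv X Y) Z.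
Proof.
move=> m; rewrite /conv.
under eq_bigr => i _ do rewrite mulr_sumr.
under [RHS]eq_bigr => i _ do rewrite mulr_suml.
rewrite [RHS]exchange_big; apply: eq_bigr => i _ /=.
rewrite [RHS](reindex_inj (addrI i)); apply: eq_bigr => j _ /=.
by rewrite mulrA [i + j - i]addrAC subrr add0r opprD addrA.
Qed.

Lemma convACA X Y (Z T : G -> K) :
  conv (conv X Y) (conv Z T) =1 conv (conv X Z) (conv Y T).
Proof.
move=> m; rewrite -!convA; apply: eq_conv => // {}m.
by rewrite !convA; apply: eq_conv => //; apply: convC.
Qed.

Lemma corrE X : corr X =1 conv (X \o -%R) X.
Proof.
move=> m; rewrite /corr /conv (reindex_inj oppr_inj).
rewrite [RHS](reindex_inj oppr_inj) [LHS](reindex_inj oppr_inj) /=.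
by apply: eq_bigr => i _; rewrite !opprK addrC.
Qed.

Lemma corrN X m : corr X (- m) = corr X m.
Proof.
rewrite /corr (reindex_inj (addIr m)); apply: eq_bigr => i _.
by rewrite addrK mulrC.
Qed.

Lemma convN X Y : conv X Y \o -%R =1 conv (X \o -%R) (Y \o -%R).
Proof.
move=> m; rewrite /= /conv (reindex_inj oppr_inj).
by apply: eq_bigr => i _ /=; rewrite opprB opprK addrC.
Qed.

(** Reflection is an automorphism of the group algebra, which is commutative, so the four factors of
    [(X Y)^- (X Y)] regroup as [(X^- X) (Y^- Y)]. *)
Lemma corr_conv X Y : corr (conv X Y) =1 conv (corr X) (corr Y).
Proof.
move=> m; rewrite corrE (eq_conv (convN X Y) (frefl _)) convACA.
by apply: eq_conv => {}m; rewrite corrE.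
Qed.

Lemma corr_comp X (u : G -> G) m :
  injective u -> {morph u : a b / a + b} -> corr (X \o u) m = corr X (u m).
Proof.
move=> u_inj uD; rewrite [RHS](reindex_inj u_inj).
by apply: eq_bigr => i _ /=; rewrite uD.
Qed.

(** This is the congruence [X^- X = a] modulo [K N]; [c] stays free because only the class modulo
    [K N] matters. *)
Definition corr_flat (a : K) X :=
  exists c, forall m, corr X m = a * (m == 0)%:R + c.

Lemma corr_flat_conv a b X Y :
  corr_flat a X -> corr_flat b Y -> corr_flat (a * b) (conv X Y).
Proof.
(* The witness is the coefficient of [N] in [(a + c N) (b + d N)], since [N N = #|G| N]. *)
move=> [c cX] [d dY]; exists (a * d + c * b + c * d *+ #|G|) => m.
rewrite corr_conv (eq_conv cX dY) /conv.
have delta_sum (F : G -> K) n : \sum_i (i == n)%:R * F i = F n.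
  rewrite (bigD1 n) //= eqxx mul1r big1 ?addr0 // => i /negbTE ->.
  by rewrite mul0r.
transitivity (\sum_i ((i == 0)%:R * (a * b * (m - i == 0)%:R)
    + (i == 0)%:R * (a * d) + (i == m)%:R * (c * b) + c * d)).
  by apply: eq_bigr => i _; rewrite subr_eq0 [m == i]eq_sym; ring.
by rewrite !big_split /= !delta_sum subr0 sumr_const -!addrA.
Qed.

(** Subtracting [t N] does not change the class modulo [K N], and the sign cancels against that of
    the reflected factor. The new constant comes from [X N = (\sum_i X i) N] and [N N = #|G| N]. *)
Lemma corr_flat_oppB a t X :
  corr_flat a X -> corr_flat a (fun m => - (X m - t)).
Proof.
move=> [c cX]; exists (c - t * (\sum_i X i) *+ 2 + t * t *+ #|G|) => m.
rewrite addrA addrA -cX /corr.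
transitivity (\sum_i (X i * X (i + m) - t * X i - t * X (i + m) + t * t)).
  by apply: eq_bigr => i _; ring.
rewrite !big_split /= sumr_const !sumrN -!mulr_sumr.
have -> : \sum_i X (i + m) = \sum_i X i by rewrite [RHS](reindex_inj (addIr m)).
ring.
Qed.

Lemma corr_flat_comp a X (u : G -> G) :
  injective u -> {morph u : b c / b + c} ->
  corr_flat a X -> corr_flat a (X \o u).
Proof.
move=> u_inj uD [c cX]; exists c => m; rewrite corr_comp // cX.
have u0 : u 0 = 0 by apply: (addrI (u 0)); rewrite -uD !addr0.
by rewrite -{1}u0 (inj_eq u_inj).
Qed.

End Convolution.

(** * Vectors as functions on Z/l, the maps [phi_d], and regularity of [q] *)

Section Coordinates.

Variables (K : fieldType) (l : nat).
Hypothesis l_gt1 : (1 < l)%N.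
Implicit Types x y : 'rV[K]_(l.-1).

Lemma eqr_Zp_nat (a b : nat) : (a%:R == b%:R :> 'Z_l) = (a == b %[mod l]).
Proof. by rewrite -val_eqE /= !val_Zp_nat. Qed.

Lemma sum_Zp_nat (F : 'Z_l -> K) :
  F 0 = 0 -> \sum_(1 <= i < l) F i%:R = \sum_a F a.
Proof.
move=> F0; transitivity (\sum_(0 <= i < l) F i%:R).
  by rewrite [RHS]big_ltn ?F0 ?add0r // ltnW.
move: l_gt1 F {F0}; case: l => [|[|n]] // _ F; rewrite big_mkord.
by apply: eq_bigr => i _; rewrite natr_Zp.
Qed.

(** The range includes [k = l], where both sides vanish; this covers the wrap-around factor
    [x_(i+1)] at [i = l - 1] in [q]. *)
Lemma coord_mod_nat x (k : nat) :
  (k <= l)%N -> (0 < k)%N ->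
  coord_mod x k%:R = \sum_(j < l.-1) (j.+1 == k)%:R * x 0 j.
Proof.
move=> le_kl k_gt0; rewrite /coord_mod big_mkcond; apply: eq_bigr => j _.
have lt_jl : (j.+1 < l)%N by have := ltn_ord j; lia.
rewrite eqr_Zp_nat (modn_small lt_jl).
have [->|ne_kl] := eqVneq k l; first by rewrite modnn (ltn_eqF lt_jl) mul0r.
by rewrite modn_small 1?ltn_neqAle ?ne_kl //; case: eqP; rewrite ?mul1r ?mul0r.
Qed.

Lemma coord_mod0 x : coord_mod x 0 = 0.
Proof.
rewrite /coord_mod big_pred0 // => j; rewrite -[0]/(0%:R) eqr_Zp_nat.
by rewrite mod0n modn_small //; have := ltn_ord j; lia.
Qed.

Lemma coord_modS x (j : 'I_(l.-1)) : coord_mod x j.+1%:R = x 0 j.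
Proof.
have lt_jl := ltn_ord j; rewrite coord_mod_nat //; last by lia.
rewrite (bigD1 j) //= eqxx mul1r big1 ?addr0 // => i ne_ij.
by rewrite eqSS val_eqE (negbTE ne_ij) mul0r.
Qed.

Lemma coord_modP c x y a :
  coord_mod (c *: x + y) a = c * coord_mod x a + coord_mod y a.
Proof.
rewrite /coord_mod mulr_sumr -big_split; apply: eq_bigr => j _.
by rewrite !mxE.
Qed.

Lemma coord_mod_inj x y : coord_mod x =1 coord_mod y -> x = y.
Proof. by move=> exy; apply/rowP => k; rewrite -!coord_modS. Qed.

Lemma f_formE m x :
  f_form m x = corr (coord_mod x) m%:R - corr (coord_mod x) m.+1%:R.
Proof.
rewrite /f_form /corr addn1 -!sum_Zp_nat ?coord_mod0 ?mul0r //.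
by congr (_ - _); apply: eq_bigr => i _; rewrite natrD.
Qed.

(** The equations of [V] link consecutive autocorrelations, making them equal at [1, ..., (l-1)/2].
    As [l] is odd, every other nonzero residue is the negative of one of these, and autocorrelation
    is even. *)
Lemma in_V_corr_flat x :
  odd l -> in_V x -> corr_flat (q_form x) (coord_mod x).
Proof.
move=> l_odd Vx; set A := corr (coord_mod x).
have step m : (0 < m <= (l.-1)./2)%N -> A m%:R = A 1.
  elim: m => [|[|m] IHm] // le_m.
  rewrite -IHm; last by lia.
  by apply/esym/eqP; rewrite -subr_eq0 -f_formE Vx //; lia.
(* [q] is [A 0 - A 1], so the common value off 0 is the constant. *)
exists (A 1) => m; rewrite /q_form f_formE -/A.
have [->|m_neq0] := eqVneq m 0; first by rewrite mulr1 subrK.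
rewrite mulr0 add0r; have := m_neq0; rewrite -[m]natr_Zp.
have lt_ml : (m < l)%N by rewrite -[ltnRHS]Zp_cast.
move: (nat_of_ord m) lt_ml => {m m_neq0} m lt_ml.
rewrite -[0]/(0%:R) eqr_Zp_nat mod0n modn_small // -lt0n => m_gt0.
have [le_m|lt_m] := leqP m (l.-1)./2; first by rewrite step ?m_gt0.
have -> : m%:R = - (l - m)%:R :> 'Z_l.
  by rewrite natrB ?(ltnW lt_ml) // pchar_Zp // sub0r opprK.
by rewrite /A corrN -/A step //; lia.
Qed.

Lemma corr_flat_in_V a x :
  (2 < l)%N -> corr_flat a (coord_mod x) -> in_V x /\ q_form x = a.
Proof.
move=> l_gt2 [c cX]; split=> [m le_m|].
  rewrite f_formE !cX -[0]/(0%:R) !eqr_Zp_nat mod0n !modn_small; try lia.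
  by case: m le_m => [|m] //; rewrite mulr0 subrr.
rewrite /q_form f_formE !cX -[0 in X in _ - X]/(0%:R) eqr_Zp_nat.
by rewrite mod0n modn_small // eqxx mulr1 mulr0 add0r addrK.
Qed.

(** The second sum in [phi_d] is the convolution at 0. Subtracting it picks the representative
    modulo [K N] that vanishes at 0, so the formula also holds at [a = 0], which no column
    stores. *)
Lemma coord_mod_phi (d : {unit 'Z_l}) x y a :
  coord_mod (phi_d d x y) a =
  - (conv (coord_mod x \o *%R (- (val d)^-1)) (coord_mod y) a
     - conv (coord_mod x \o *%R (- (val d)^-1)) (coord_mod y) 0).
Proof.
have sum_conv b :
    \sum_(1 <= i < l)
      coord_mod x (- (val d)^-1 * i%:R) * coord_mod y (b - i%:R) =
    conv (coord_mod x \o *%R (- (val d)^-1)) (coord_mod y) b.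
  pose F i := coord_mod x (- (val d)^-1 * i) * coord_mod y (b - i).
  by rewrite -[LHS]/(\sum_(1 <= i < l) F i%:R) sum_Zp_nat // /F mulr0
             coord_mod0 mul0r.
have [->|a_neq0] := eqVneq a 0; first by rewrite coord_mod0 subrr oppr0.
have lt_al : (a < l)%N by rewrite -[ltnRHS]Zp_cast.
have a_gt0 : (0 < a)%N by rewrite lt0n.
have lt_a : (a.-1 < l.-1)%N by lia.
rewrite -[a]natr_Zp -(prednK a_gt0) (coord_modS _ (Ordinal lt_a)) mxE.
have := sum_conv 0; under eq_bigr => i _ do rewrite sub0r.
by rewrite sum_conv => ->.
Qed.

Lemma multiplication_phi (d : {unit 'Z_l}) :
  odd l -> multiplication_map (@in_V K l) (@q_form K l) (@phi_d K l d).
Proof.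
move=> l_odd; have l_gt2 : (2 < l)%N by case: l l_gt1 l_odd => [|[|[|]]].
have flat_phi x y : in_V x -> in_V y ->
    corr_flat (q_form x * q_form y) (coord_mod (phi_d d x y)).
  move=> Vx Vy; pose u := *%R (- (val d)^-1) : 'Z_l -> 'Z_l.
  have u_inj : injective u.
    by apply: mulrI; rewrite unitrN unitrV; apply: valP.
  have flat_conv := corr_flat_conv
    (corr_flat_comp u_inj (mulrDr _) (in_V_corr_flat l_odd Vx))
    (in_V_corr_flat l_odd Vy).
  have [c cP] :=
    corr_flat_oppB (conv (coord_mod x \o u) (coord_mod y) 0) flat_conv.
  exists c => m; rewrite -cP; apply: eq_bigr => i _.
  by rewrite !coord_mod_phi.
split=> [|x y Vx Vy|x y Vx Vy]; first split=> [y c x x'|x c y y'].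
- apply: coord_mod_inj => a; rewrite coord_modP !coord_mod_phi.
  have lin b := conv_linearl (coord_mod y) b
    (fun i => coord_modP c x x' (- (val d)^-1 * i)).
  by rewrite !lin; ring.
- apply: coord_mod_inj => a; rewrite coord_modP !coord_mod_phi.
  have lin b := conv_linearr (coord_mod x \o *%R (- (val d)^-1)) b
    (coord_modP c y y').
  by rewrite !lin; ring.
- by have [] := corr_flat_in_V l_gt2 (flat_phi x y Vx Vy).
- by have [_ ->] := corr_flat_in_V l_gt2 (flat_phi x y Vx Vy).
Qed.

Lemma regular_q_form :
  2 != 0 :> K -> l%:R != 0 :> K -> regular_quadratic_form (@q_form K l).
Proof.
move=> two_neq0 l_neq0.
(* [B] is read off the terms of [q]; its symmetrisation [A] is half the Cartan matrix of type A of
   rank [l - 1]. *)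
pose B := \matrix_(i < l.-1, j < l.-1) ((i == j)%:R - (i.+1 == j)%:R : K).
pose A := 2^-1 *: (B + B^T).
have qB x : q_form x = \sum_i \sum_j B i j * x 0 i * x 0 j.
  rewrite /q_form /f_form !big_add1 !big_mkord -sumrB; apply: eq_bigr => i _.
  have lt_il := ltn_ord i.
  rewrite addn0 !addn1 !coord_modS coord_mod_nat //; last by lia.
  rewrite -mulrBr.
  transitivity (x 0 i * \sum_j ((i == j)%:R - (i.+1 == j)%:R) * x 0 j).
    congr (_ * _); rewrite -[in X in X - _]coord_modS coord_mod_nat -?sumrB.
    2-3: by lia.
    by apply: eq_bigr => j _; rewrite !eqSS ![(j : nat) == _]eq_sym -mulrBl.
  by rewrite mulr_sumr; apply: eq_bigr => j _; rewrite !mxE; ring.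
exists A; split=> [|x|].
- by rewrite /A linearZ linearD /= trmxK addrC.
- have qBT : q_form x = \sum_i \sum_j B^T i j * x 0 i * x 0 j.
    rewrite qB exchange_big; apply: eq_bigr => i _; apply: eq_bigr => j _.
    by rewrite !mxE mulrAC.
  apply: (mulfI two_neq0); rewrite [LHS]mulr_natl mulr2n.
  rewrite {1}qB qBT -big_split mulr_sumr; apply: eq_bigr => i _ /=.
  rewrite -big_split mulr_sumr; apply: eq_bigr => j _ /=.
  by rewrite !mxE; field.
- rewrite unitmxE unitfE; apply/det0P => -[v v_neq0 vA0].
  (* Extending [v] by 0 at indices 0 and [l] lets the first and last equations obey the same
     recurrence as the others. *)
  pose u k := \sum_(i < l.-1) (i.+1 == k)%:R * v 0 i.
  have uS (i : 'I_(l.-1)) : u i.+1 = v 0 i.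
    rewrite -coord_modS coord_mod_nat //; have := ltn_ord i; lia.
  have u0 : u 0%N = 0 by apply: big1 => i _; rewrite mul0r.
  have ul : u l = 0.
    apply: big1 => i _; rewrite ltn_eqF ?mul0r //; have := ltn_ord i; lia.
  have rec k : (k < l.-1)%N -> u k.+2 = 2 * u k.+1 - u k.
    move=> lt_kl; apply/eqP; rewrite eq_sym -subr_eq0; apply/eqP.
    (* Twice entry [k] of [v *m A] is [2 u_(k+1) - u_k - u_(k+2)]; the factor 2 clears the [2^-1] in
       [A]. *)
    transitivity (2 * (v *m A) 0 (Ordinal lt_kl));
      last by rewrite vA0 mxE mulr0.
    rewrite !mxE !mulr_sumr -!sumrB; apply: eq_bigr => i _.
    rewrite !mxE -!val_eqE /= !eqSS [k == i]eq_sym [k.+1 == i]eq_sym; field.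
    exact: two_neq0.
  (* The recurrence has order two, so the induction carries two consecutive terms. *)
  have uk k : (k < l)%N -> u k = k%:R * u 1%N /\ u k.+1 = k.+1%:R * u 1%N.
    elim: k => [|k IHk] lt_kl; first by rewrite u0 mul0r mul1r.
    have [uk uk1] := IHk (ltnW lt_kl); split=> //.
    by rewrite rec ?uk ?uk1; [rewrite -!natr1; ring | lia].
  have u1 : u 1%N = 0.
    have [|_] := uk l.-1; first by rewrite ltn_predL ltnW.
    rewrite prednK ?(ltnW l_gt1) // ul => /esym/eqP.
    by rewrite mulf_eq0 (negbTE l_neq0) => /eqP.
  case/eqP: v_neq0; apply/rowP => i; rewrite mxE -uS.
  have [|_ ->] := uk i; first by have := ltn_ord i; lia.
  by rewrite u1 mulr0.
Qed.

End Coordinates.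

Theorem theorem1p4 (K : fieldType) (l : nat)
    (l_prime : prime l) (l_odd : odd l)
    (charK2 : 2%N \notin [pchar K]) (charKl : l \notin [pchar K])
    (L : splittingFieldType K) (zeta : L)
    (zeta_prim : l.-primitive_root zeta)
    (galK : 'Gal(<<1%VS; zeta>>%VS / 1%VS) \isog units_Zp l) :
  [/\ regular_quadratic_form (@q_form K l),
      multiplicative_on (@in_V K l) (@q_form K l)
    & forall d : {unit 'Z_l},
        multiplication_map (@in_V K l) (@q_form K l) (@phi_d K l d)].
Proof.
have l_gt1 := prime_gt1 l_prime; split.
- apply: regular_q_form => //.
  by apply: contra charKl => l_eq0; rewrite inE l_prime l_eq0.
- by exists (@phi_d K l 1%g); apply: multiplication_phi.
- by move=> d; apply: multiplication_phi.
Qed.
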